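(* Let $A\in\mathbb{R}^{m\times n}$, $\beta>0$, and $M=A^\top A+\beta I\in\mathbb{R}^{n\times n}$. Let $s\in\mathbb{R}^n$ with $s\neq 0$, and let $l=Ms$. Let $H\in\mathbb{R}^{n\times n}$ be a symmetric matrix and define $$H_{\rm next}=H-\frac{H l s^\top+s l^\top H}{s^\top l}+\left(1+\frac{l^\top H l}{s^\top l}\right)\frac{s s^\top}{s^\top l}.$$ If $H\preceq M^{-1}$, then $H_{\rm next}\preceq M^{-1}$.
   Context: For real symmetric matrices $P,Q$, $P\preceq Q$ means that $Q-P$ is positive semidefinite. Since $\beta>0$, $M$ is symmetric positive definite, so $s^\top l=s^\top M s>0$ when $s\ne 0$. The matrix $H_{\rm next}$ is the BFGS update of the (inverse-Hessian approximation) matrix $H$ with respect to the pair $(s,l)$. *)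

(* Defs.v *)
From mathcomp Require Import all_boot all_order all_algebra.
From mathcomp Require Import sesquilinear reals.
Set Implicit Arguments.
Unset Strict Implicit.
Unset Printing Implicit Defensive.
Import Order.TTheory GRing.Theory Num.Theory.
Local Open Scope ring_scope.

(* Vectors are columns; the entry (0, 0) of a 1 x 1 product is the scalar it
   denotes. *)

Definition psdmx (R : realType) (n : nat) (P : 'M[R]_n) : Prop :=
  P \is symmetricmx /\ forall x : 'cV[R]_n, 0 <= (x^T *m P *m x) 0 0.

Definition loewner_le (R : realType) (n : nat) (P Q : 'M[R]_n) : Prop :=
  psdmx (Q - P).

(* BFGS update of an inverse-Hessian approximation H for the pair (s, l). *)
Definition bfgs_update (R : realType) (n : nat)
    (H : 'M[R]_n) (s l : 'cV[R]_n) : 'M[R]_n :=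
  let sl := (s^T *m l) 0 0 in
  let lHl := (l^T *m H *m l) 0 0 in
  H - sl^-1 *: (H *m l *m s^T + s *m l^T *m H)
    + ((1 + lHl / sl) / sl) *: (s *m s^T).

(* Main.v *)
Require Import Defs.
From mathcomp Require Import all_boot all_order all_algebra.
From mathcomp Require Import sesquilinear reals.
From mathcomp Require Import ring.
Set Implicit Arguments.
Unset Strict Implicit.
Unset Printing Implicit Defensive.
Import Order.TTheory GRing.Theory Num.Theory.
Local Open Scope ring_scope.

(** With V = 1 - l s^T / (s^T l), the BFGS update reads
    V^T H V + s s^T / (s^T l), which is affine in H. Since M^-1 l = s, the
    update fixes M^-1, and hence M^-1 - H_next = V^T (M^-1 - H) V. *)

(** [symmetricmx] is the hermitian predicate with sign $(-1)^0$ and the identity as conjugation;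
    both are stripped here. *)
Lemma symmetricmxP (R : fieldType) (n : nat) (P : 'M[R]_n) :
  reflect (P^T = P) (P \is symmetricmx).
Proof.
rewrite is_hermitianmxE expr0 scale1r map_mx_id //.
by apply: (iffP eqP) => [<-|->].
Qed.

Lemma tr_mulmx_self_ge0 (R : realDomainType) (m : nat) (x : 'cV[R]_m) :
  0 <= (x^T *m x) 0 0.
Proof.
by rewrite mxE sumr_ge0 // => i _; rewrite mxE -expr2 sqr_ge0.
Qed.

Lemma tr_mulmx_self_gt0 (R : realDomainType) (n : nat) (x : 'cV[R]_n) :
  x != 0 -> 0 < (x^T *m x) 0 0.
Proof.
move=> x_neq0; rewrite lt_def tr_mulmx_self_ge0 andbT.
apply: contra_neq x_neq0; rewrite mxE => sum0; apply/colP => i.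
have sq_ge0 (j : 'I_n) : true -> 0 <= x^T 0 j * x j 0.
  by rewrite mxE -expr2 sqr_ge0.
have := psumr_eq0P sq_ge0 sum0 (i := i) isT.
by rewrite !mxE => /eqP; rewrite mulf_eq0 orbb => /eqP.
Qed.

(** The form splits as $|Ax|^2 + \beta |x|^2$. This gives both the invertibility of $M$ and $s^T l >
    0$. *)
Lemma regularized_gram_gt0 (R : realFieldType) (m n : nat) (A : 'M[R]_(m, n))
    (beta : R) (x : 'cV[R]_n) :
  0 < beta -> x != 0 -> 0 < (x^T *m ((A^T *m A + beta%:M) *m x)) 0 0.
Proof.
move=> beta_gt0 x_neq0.
rewrite mulmxDl mulmxDr mul_scalar_mx -scalemxAr !mulmxA -trmx_mul -mulmxA mxE.
by rewrite ltr_wpDl ?tr_mulmx_self_ge0 // mxE mulr_gt0 ?tr_mulmx_self_gt0.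
Qed.

Lemma regularized_gram_unit (R : realFieldType) (m n : nat) (A : 'M[R]_(m, n))
    (beta : R) : 0 < beta -> A^T *m A + beta%:M \in unitmx.
Proof.
(* Row freeness concerns row vectors, so it is tested on the transpose: a relation $v M^T = 0$
   becomes $M v^T = 0$, against positivity at $v^T$. *)
move=> beta_gt0; rewrite -unitmx_tr -row_free_unit; apply/inj_row_free => v.
move=> /(congr1 trmx); rewrite trmx_mul trmxK trmx0 => Mv0.
apply: trmx_inj; rewrite trmx0; apply/eqP; apply: contraTT isT => v_neq0.
by have := regularized_gram_gt0 A beta_gt0 v_neq0; rewrite Mv0 mulmx0 mxE ltxx.
Qed.

(** The identity is polynomial in [r], so it survives $s^T l = 0$, where [r] is 0 by convention. *)
Lemma bfgs_updateE (R : realType) (n : nat) (H : 'M[R]_n) (s l : 'cV[R]_n) :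
  let r := ((s^T *m l) 0 0)^-1 in
  let V := 1%:M - r *: (l *m s^T) in
  bfgs_update H s l = V^T *m H *m V + r *: (s *m s^T).
Proof.
move=> r V; rewrite /bfgs_update -/r.
have VT : V^T = 1%:M - r *: (s *m l^T).
  by rewrite /V linearB linearZ /= trmx1 trmx_mul trmxK.
(* The inner factor $l^T H l$ is a 1 x 1 matrix, hence comes out as a scalar. *)
have sandwich : s *m l^T *m H *m (l *m s^T) = (l^T *m H *m l) 0 0 *: (s *m s^T).
  rewrite scalemxAr -mul_scalar_mx -mx11_scalar.
  by rewrite !mulmxA.
rewrite VT mulmxBl mul1mx !mulmxBr !mulmx1 -!scalemxAl -!scalemxAr.
rewrite mulmxBl -!scalemxAl sandwich mulmxA.
apply/matrixP => i j; rewrite !mxE; ring.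
Qed.

(** Both cross terms become $s s^T$, and $l^T N l = s^T l$ turns the last coefficient into $2 / (s^T
    l)$, so the corrections cancel. *)
Lemma bfgs_update_fixed (R : realType) (n : nat) (N : 'M[R]_n)
    (s l : 'cV[R]_n) :
  (s^T *m l) 0 0 != 0 -> N *m l = s -> l^T *m N = s^T ->
  bfgs_update N s l = N.
Proof.
move=> sl_neq0 Nl lN; rewrite /bfgs_update Nl -(mulmxA s) lN divff //.
apply/matrixP => i j; rewrite !mxE; ring.
Qed.

Lemma psdmx_congr (R : realType) (n : nat) (P V : 'M[R]_n) :
  psdmx P -> psdmx (V^T *m P *m V).
Proof.
move=> [/symmetricmxP P_sym P_ge0]; split.
  by apply/symmetricmxP; rewrite !trmx_mul trmxK P_sym mulmxA.
by move=> x; have := P_ge0 (V *m x); rewrite trmx_mul !mulmxA.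
Qed.

Theorem theorem2p2 (R : realType) (m n : nat) (A : 'M[R]_(m, n)) (beta : R)
    (s : 'cV[R]_n) (H : 'M[R]_n) :
  let M : 'M[R]_n := A^T *m A + beta%:M in
  let l : 'cV[R]_n := M *m s in
  0 < beta ->
  s != 0 ->
  H \is symmetricmx ->
  loewner_le H (invmx M) ->
  loewner_le (bfgs_update H s l) (invmx M).
Proof.
move=> M l beta_gt0 s_neq0 _ H_le.
have M_unit : M \in unitmx by exact: regularized_gram_unit.
have M_sym : M^T = M.
  by rewrite /M linearD /= trmx_mul trmxK tr_scalar_mx.
have sl_neq0 : (s^T *m l) 0 0 != 0.
  by rewrite gt_eqF //; exact: regularized_gram_gt0.
have Ml : invmx M *m l = s by rewrite mulKmx.
have lM : l^T *m invmx M = s^T by rewrite trmx_mul M_sym mulmxK.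
(* Once [invmx M] is replaced by its own update, both terms have the same $V$ and the same rank-one
   summand, since these depend on [s] and [l] alone; the summand drops out of the difference. *)
rewrite /loewner_le -[X in psdmx (X - _)](bfgs_update_fixed sl_neq0 Ml lM).
rewrite !bfgs_updateE /= opprD addrACA subrr addr0 -mulmxBl -mulmxBr.
exact: psdmx_congr.
Qed.
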